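(* Let $R$ be a commutative noetherian ring, $\mathfrak a$ an ideal of $R$, $M$ a finitely generated $R$-module and let $r\ge 1$ be an integer. The following statements are equivalent: (i) $H^i_{\mathfrak a}(M)=0$ for all $i\ge r$. (ii) $H^i_{\mathfrak a}(M)$ is finitely generated for all $i\ge r$. (iii) $H^i_{\mathfrak a}(M)$ is coatomic for all $i\ge r$.
   Context: $H^i_{\mathfrak a}(M)$ denotes the $i$-th local cohomology module of $M$ with respect to $\mathfrak a$. A module is coatomic if each of its proper submodules is contained in a maximal (proper) submodule. *)

(* Defs.v *)
From HB Require Import structures.
From mathcomp Require Import all_boot all_order all_algebra.
From mathcomp Require Import boolp classical_sets.

Set Implicit Arguments.
Unset Strict Implicit.
Unset Printing Implicit Defensive.

Import GRing.Theory.

Local Open Scope classical_set_scope.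
Local Open Scope ring_scope.
Local Open Scope quotient_scope.

(* A submodule of V is a [submodClosed V].  Submodules given by a Prop-valued
   condition become boolean predicates through [`[< _ >]] (classical logic).
   The base ring is a [comPzRingType], so the zero ring is allowed. *)

Section Submodules.
Variables (R : comPzRingType) (V : lmodType R).

Lemma submod_opp (N : submodClosed V) (x : V) : x \in N -> - x \in N.
Proof. by move=> Nx; rewrite -scaleN1r rpredZ. Qed.

Lemma submod_sub (N : submodClosed V) (x y : V) :
  x \in N -> y \in N -> x - y \in N.
Proof. by move=> Nx Ny; rewrite rpredD ?submod_opp. Qed.

Definition span (S : set V) : {pred V} :=
  fun x => `[< forall N : submodClosed V, (forall y, S y -> y \in N) -> x \in N >].

Fact span_closed (S : set V) : GRing.subsemimod_closed (span S).
Proof.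
split; first split.
- by apply/asboolP => N _; rewrite rpred0.
- move=> x y /asboolP Sx /asboolP Sy; apply/asboolP => N SN.
  by rewrite rpredD ?Sx ?Sy.
- by move=> c x /asboolP Sx; apply/asboolP => N SN; rewrite rpredZ ?Sx.
Qed.

HB.instance Definition _ (S : set V) :=
  GRing.isSubmodClosed.Build R V (span S) (span_closed S).

Lemma mem_span (S : set V) x : S x -> x \in span S.
Proof. by move=> Sx; apply/asboolP => N; apply. Qed.

Lemma span_min (S : set V) (N : submodClosed V) :
  (forall y, S y -> y \in N) -> {subset span S <= N}.
Proof. by move=> SN x /asboolP; apply. Qed.

Definition proper_submod (N : submodClosed V) : Prop := exists x, x \notin N.

Definition maximal_submod (N : submodClosed V) : Prop :=
  proper_submod N /\
  forall P : submodClosed V,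
    proper_submod P -> {subset N <= P} -> {subset P <= N}.

End Submodules.

Section ModuleProperties.
Variables (R : comPzRingType) (V : lmodType R).

Definition zero_module : Prop := forall x : V, x = 0.

Definition finitely_generated : Prop :=
  exists s : seq V, forall x : V, x \in span [set y | y \in s].

Definition coatomic : Prop :=
  forall N : submodClosed V, proper_submod N ->
    exists2 P : submodClosed V, maximal_submod P & {subset N <= P}.

Definition injective_module : Prop :=
  forall (A B : lmodType R) (f : {linear A -> B}) (g : {linear A -> V}),
    injective f -> exists h : {linear B -> V}, forall x, h (f x) = g x.

End ModuleProperties.

Notation ideal R := (submodClosed R^o).

Definition noetherian (R : comPzRingType) : Prop :=
  forall I : ideal R, exists s : seq R^o, I =i span [set y | y \in s].

Section SubmoduleType.
Variables (R : comPzRingType) (V : lmodType R) (N : submodClosed V).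

Definition submod : Type := {x : V | x \in N}.

HB.instance Definition _ := [isSub of submod for @sval V (fun x => x \in N)].
HB.instance Definition _ := [Choice of submod by <:].
Fact submod_subproof : GRing.subsemimod_closed (mem N).
Proof.
split; first split; first exact: rpred0.
  by move=> x y; apply: rpredD.
by move=> c x; apply: rpredZ.
Qed.
HB.instance Definition _ :=
  GRing.SubChoice_isSubLmodule.Build R V _ submod submod_subproof.

End SubmoduleType.

Section QuotientModule.
Variables (R : comPzRingType) (V : lmodType R) (N : submodClosed V).

Definition quot_equiv (x y : V) : bool := x - y \in N.

Fact quot_equiv_is_equiv : equiv_class_of quot_equiv.
Proof.
split=> [x|x y|y x z]; rewrite /quot_equiv ?subrr ?rpred0 //.
  by apply/idP/idP => /submod_opp; rewrite opprB.
by move=> xy yz; rewrite -[x](addrNK y) -addrA rpredD.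
Qed.

Canonical quot_equivRel := EquivRelPack quot_equiv_is_equiv.
Canonical quot_encModRel := defaultEncModRel quot_equiv.

Definition quot_module := {eq_quot quot_equiv}.

HB.instance Definition _ : EqQuotient V quot_equiv quot_module :=
  EqQuotient.on quot_module.
HB.instance Definition _ := Choice.on quot_module.

Let pi : V -> quot_module := \pi_quot_module.

Lemma quot_eqE (x y : V) : (pi x = pi y) <-> x - y \in N.
Proof.
rewrite (_ : (x - y \in N) = (pi x == pi y)); first by split=> /eqP.
by rewrite /pi piE.
Qed.

Let repr_sub (x : V) : repr (pi x) - x \in N.
Proof. by apply/quot_eqE; rewrite /pi reprK. Qed.

Definition quot_zero : quot_module := pi 0.
Definition quot_add (x y : quot_module) : quot_module := pi (repr x + repr y).
Definition quot_opp (x : quot_module) : quot_module := pi (- repr x).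
Definition quot_scale (c : R) (x : quot_module) : quot_module :=
  pi (c *: repr x).

Let pi_add x y : quot_add (pi x) (pi y) = pi (x + y).
Proof. by apply/quot_eqE; rewrite opprD addrACA rpredD ?repr_sub. Qed.

Let pi_opp x : quot_opp (pi x) = pi (- x).
Proof. by apply/quot_eqE; rewrite -opprD submod_opp ?repr_sub. Qed.

Let pi_scale c x : quot_scale c (pi x) = pi (c *: x).
Proof. by apply/quot_eqE; rewrite -scalerBr rpredZ ?repr_sub. Qed.

Let piW (P : quot_module -> Prop) : (forall x, P (pi x)) -> forall q, P q.
Proof. by move=> Ppi q; rewrite -[q]reprK; apply: Ppi. Qed.

Fact quot_addA : associative quot_add.
Proof. by do 3!elim/piW => ?; rewrite !pi_add addrA. Qed.
Fact quot_addC : commutative quot_add.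
Proof. by do 2!elim/piW => ?; rewrite !pi_add addrC. Qed.
Fact quot_add0 : left_id quot_zero quot_add.
Proof. by elim/piW => x; rewrite pi_add add0r. Qed.
Fact quot_addN : left_inverse quot_zero quot_opp quot_add.
Proof. by elim/piW => x; rewrite pi_opp pi_add addNr. Qed.

HB.instance Definition _ :=
  GRing.isZmodule.Build quot_module quot_addA quot_addC quot_add0 quot_addN.

Fact quot_scaleA b c x : quot_scale b (quot_scale c x) = quot_scale (b * c) x.
Proof. by elim/piW: x => x; rewrite !pi_scale scalerA. Qed.
Fact quot_scale1 : left_id 1 quot_scale.
Proof. by elim/piW => x; rewrite pi_scale scale1r. Qed.
Fact quot_scaleDr : right_distributive quot_scale +%R.
Proof.
move=> c; elim/piW => x; elim/piW => y.
rewrite -![LHS]/(quot_scale c (quot_add _ _)) -![RHS]/(quot_add _ _).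
by rewrite pi_add !pi_scale pi_add scalerDr.
Qed.
Fact quot_scaleDl x : {morph quot_scale^~ x : b c / b + c}.
Proof.
elim/piW: x => x b c; rewrite -![RHS]/(quot_add _ _).
by rewrite !pi_scale pi_add scalerDl.
Qed.

HB.instance Definition _ := GRing.Zmodule_isLmodule.Build R quot_module
  quot_scaleA quot_scale1 quot_scaleDr quot_scaleDl.

Definition quot_proj : V -> quot_module := \pi_quot_module.

Fact quot_proj_linear : linear quot_proj.
Proof. by move=> c x y; rewrite /quot_proj -/pi -pi_add -pi_scale. Qed.
HB.instance Definition _ :=
  GRing.isLinear.Build R V quot_module _ quot_proj quot_proj_linear.

Lemma quot_proj_eq (x y : V) : quot_proj x = quot_proj y <-> x - y \in N.
Proof. exact: quot_eqE. Qed.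

Lemma quot_proj_surj (q : quot_module) : exists x, quot_proj x = q.
Proof. by exists (repr q); rewrite /quot_proj reprK. Qed.

End QuotientModule.

Section Kernel.
Variables (R : comPzRingType) (V W : lmodType R) (f : {linear V -> W}).

Definition ker : {pred V} := fun x => f x == 0.

Fact ker_closed : GRing.subsemimod_closed ker.
Proof.
split; first split; first by rewrite unfold_in /ker linear0.
  by move=> x y /eqP fx /eqP fy; rewrite unfold_in /ker linearD fx fy addr0.
by move=> c x /eqP fx; rewrite unfold_in /ker linearZ /= fx scaler0.
Qed.
HB.instance Definition _ := GRing.isSubmodClosed.Build R V ker ker_closed.

End Kernel.

Section CochainComplexes.
Variable R : comPzRingType.

Record complex := Complex {
  cobj :> nat -> lmodType R;
  cdiff : forall i, {linear cobj i -> cobj i.+1};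
  cdiff_cdiff : forall i x, cdiff i.+1 (cdiff i x) = 0 }.

Definition cocycles (C : complex) (i : nat) : lmodType R :=
  submod (ker (cdiff C i)).

(* The incoming differential in degree 0 is zero. *)
Definition coboundary (C : complex) (i : nat) : {pred cocycles C i} :=
  match i return {pred cocycles C i} with
  | 0%N => fun z => z == 0
  | j.+1 => fun z => `[< exists y : C j, cdiff C j y = val z >]
  end.

Fact coboundary_closed C i : GRing.subsemimod_closed (@coboundary C i).
Proof.
case: i => [|i]; split; try split.
- exact/eqP.
- by move=> x y /eqP-> /eqP->; rewrite addr0; apply/eqP.
- by move=> c x /eqP->; rewrite scaler0; apply/eqP.
- by apply/asboolP; exists 0; rewrite linear0.
- move=> x y /asboolP[u fu] /asboolP[v fv]; apply/asboolP.
  by exists (u + v); rewrite linearD fu fv.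
- move=> c x /asboolP[u fu]; apply/asboolP.
  by exists (c *: u); rewrite linearZ /= fu.
Qed.
HB.instance Definition _ C i :=
  GRing.isSubmodClosed.Build R (cocycles C i) (@coboundary C i)
    (coboundary_closed C i).

Definition cohomology (C : complex) (i : nat) : lmodType R :=
  quot_module (@coboundary C i).

Record injective_resolution (M : lmodType R) := InjectiveResolution {
  ires_complex :> complex;
  ires_aug : {linear M -> ires_complex 0%N};
  ires_aug_inj : injective ires_aug;
  ires_exact0 : forall x, cdiff ires_complex 0 x = 0 <->
                  exists m, ires_aug m = x;
  ires_exactS : forall i x, cdiff ires_complex i.+1 x = 0 <->
                  exists y, cdiff ires_complex i y = x;
  ires_injective : forall i, injective_module (ires_complex i) }.

End CochainComplexes.

Section Torsion.
Variables (R : comPzRingType) (a : ideal R).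

(* The ideal power a^n; for n = 0 the only generator is the empty product 1. *)
Definition ideal_exp (n : nat) : {pred R^o} :=
  span [set c : R^o | exists2 f : 'I_n -> R,
    (forall i, f i \in a) & c = \prod_(i < n) f i].

Lemma ideal_expD m n : {subset ideal_exp (m + n) <= ideal_exp m}.
Proof.
apply: span_min => _ [f fa ->]; rewrite big_split_ord /= mulrC.
apply: (@rpredZ R R^o (span _)); apply: mem_span.
by exists (fun i => f (lshift n i)).
Qed.

(* Gamma_a(V) as a submodule of V. *)
Definition torsion (V : lmodType R) : {pred V} :=
  fun x => `[< exists n, forall c : R, c \in ideal_exp n -> c *: x = 0 >].

Fact torsion_closed V : GRing.subsemimod_closed (@torsion V).
Proof.
split; first split; first by apply/asboolP; exists 0%N => c _; rewrite scaler0.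
- move=> x y /asboolP[m mx] /asboolP[n ny]; apply/asboolP; exists (m + n)%N.
  move=> c cmn; rewrite scalerDr mx ?ny ?addr0 //; last exact: ideal_expD cmn.
  by apply: (@ideal_expD n m); rewrite addnC.
- move=> b x /asboolP[n nx]; apply/asboolP; exists n => c cn.
  by rewrite scalerA mulrC -scalerA nx ?scaler0.
Qed.
HB.instance Definition _ (V : lmodType R) :=
  GRing.isSubmodClosed.Build R V (@torsion V) (@torsion_closed V).

Definition torsion_module (V : lmodType R) : lmodType R := submod (@torsion V).

Section TorsionMap.
Variables (V W : lmodType R) (f : {linear V -> W}).

Fact torsion_map_subproof (x : torsion_module V) : f (val x) \in @torsion W.
Proof.
have /asboolP[n nx] := valP x; apply/asboolP; exists n => c cn.
by rewrite -linearZ /= nx ?linear0.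
Qed.

Definition torsion_map (x : torsion_module V) : torsion_module W :=
  Sub (f (val x)) (torsion_map_subproof x).

Fact torsion_map_linear : linear torsion_map.
Proof. by move=> c x y; apply: val_inj; rewrite /= linearP. Qed.
HB.instance Definition _ := GRing.isLinear.Build R (torsion_module V)
  (torsion_module W) _ torsion_map torsion_map_linear.

End TorsionMap.

Section TorsionComplex.
Variable C : complex R.

Fact torsion_complex_subproof i (x : torsion_module (C i)) :
  torsion_map (cdiff C i.+1) (torsion_map (cdiff C i) x) = 0.
Proof. by apply: val_inj; rewrite /= cdiff_cdiff. Qed.

Definition torsion_complex : complex R :=
  @Complex R (fun i => torsion_module (C i)) (fun i => torsion_map (cdiff C i))
    torsion_complex_subproof.

End TorsionComplex.

(* H^i_a(M) is the i-th right derived functor of Gamma_a at M, computed from an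
   injective resolution of M; up to isomorphism it is independent of the
   resolution, which always exists. *)
Definition local_cohomology (M : lmodType R) (I : injective_resolution M)
  (i : nat) : lmodType R := cohomology (torsion_complex I) i.

End Torsion.

(* Main.v *)
Require Import Defs.
From HB Require Import structures.
From mathcomp Require Import all_boot all_order all_algebra.
From mathcomp Require Import boolp classical_sets.

(** Only the passage from coatomic to zero has content: a zero module is
    finitely generated, and Zorn's lemma makes a finitely generated module
    coatomic.

    Let [x_1, ..., x_n] generate [a], and let [D] be the subcomplex of
    [a]-torsion elements of the injective resolution [I], so that the modules
    [H^i(D)] are the local cohomology modules.  Form the iterated mapping cone
    of multiplication by [x_1], ..., [x_n] on [D]; up to a shift this is the
    Koszul complex of [D].  Its cohomology vanishes in degrees at least 1.
    Indeed this is clear for the iterated cone on [I], as [I] is exact in these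
    degrees, and passing from an injective complex to its [x]-torsion does not
    change the cohomology of the cone of [x]: over a noetherian ring [x] is
    bijective on an injective module modulo its [x]-torsion ([cone_acyclic]).
    It remains to go back from each cone to the complex it was built on, by
    means of the exact sequences
    [H^i(C) -> H^i(cone x) -> H^(i+1)(C)] and
    [H^i(C) -> H^i(C) -> H^i(cone x)], the first map of the second sequence
    being multiplication by [x].  If the cone is acyclic in degrees at least
    [r], then [x H^i(C) = H^i(C)] for [i >= r], and some form of Nakayama's
    lemma has to conclude that [H^i(C) = 0] ([torsion_cohomology_vanishing]).

    For this one needs a class of modules which contains the coatomic
    [a]-torsion modules, is closed under submodules, quotients and extensions,
    and obeys Nakayama's lemma.  Take the modules all of whose subquotients [Y] satisfy
    [x Y = Y -> Y = 0] for the generators [x] of [a]: closure is immediate from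
    this definition ([nakayama_exact]).  That coatomic [a]-torsion modules
    belong to it is the main point about coatomic modules
    ([coatomic_nakayama]).  Suppose that [x A + B] contains [A] but [y] in [A]
    is not in [B].  Dividing by a submodule which contains [B] and is maximal
    without [y], one may assume that every nonzero submodule contains [y].
    Such a module is Artinian over a noetherian ring ([monolithic_artinian]),
    so its submodules of multiples of [x ^+ n] stabilise, and coatomicity makes
    the limit zero, although it contains [y].

    Subquotients of a module are handled as pairs of Prop-valued submodules of
    it, and subcomplexes as families of submodules of the terms of a fixed
    complex, so that taking torsion commutes with cones on the nose. *)

Set Implicit Arguments.
Unset Strict Implicit.
Unset Printing Implicit Defensive.

Import GRing.Theory.
Local Open Scope classical_set_scope.
Local Open Scope ring_scope.

(** * Prop-valued submodules *)

Lemma scalerC (R : comPzRingType) (V : lmodType R) (b c : R) (v : V) :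
  b *: (c *: v) = c *: (b *: v).
Proof. by rewrite !scalerA mulrC. Qed.

Section PropSubmodules.
Variables (R : comPzRingType) (V : lmodType R).
Implicit Types (S N : set V) (x : R).

Definition submodule S : Prop :=
  [/\ S 0, forall u v, S u -> S v -> S (u + v) & forall c u, S u -> S (c *: u)].

Lemma submodule_sub S u v : submodule S -> S u -> S v -> S (u - v).
Proof. by move=> [_ SD SZ] Su Sv; rewrite -scaleN1r; apply/SD/SZ. Qed.

Lemma submodule_closed (N : submodClosed V) : submodule [set u | u \in N].
Proof.
by split=> [|u v Nu Nv|c u Nu] /=; rewrite ?rpred0 ?rpredD ?rpredZ.
Qed.

Lemma submodule0 : submodule [set 0].
Proof.
by split=> [//|_ _ -> ->|c _ ->] /=; rewrite ?addr0 ?scaler0.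
Qed.

Lemma submoduleI S1 S2 : submodule S1 -> submodule S2 -> submodule (S1 `&` S2).
Proof.
move=> [S0 SD SZ] [T0 TD TZ]; split; first by split.
  by move=> u v [? ?] [? ?]; split; [apply: SD | apply: TD].
by move=> c u [? ?]; split; [apply: SZ | apply: TZ].
Qed.

Definition addset S1 S2 : set V :=
  [set w | exists u v, [/\ S1 u, S2 v & w = u + v]].

Lemma submodule_add S1 S2 : submodule S1 -> submodule S2 ->
  submodule (addset S1 S2).
Proof.
move=> [S0 SD SZ] [T0 TD TZ]; split; first by exists 0, 0; rewrite addr0.
- move=> _ _ [u [v [Su Tv ->]]] [u' [v' [Su' Tv' ->]]].
  by exists (u + u'), (v + v'); rewrite addrACA; split; [apply: SD|apply: TD|].
- move=> c _ [u [v [Su Tv ->]]]; exists (c *: u), (c *: v).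
  by rewrite scalerDr; split; [apply: SZ|apply: TZ|].
Qed.

Definition line (v : V) : set V := [set w | exists c, w = c *: v].

Lemma submodule_line v : submodule (line v).
Proof.
split; first by exists 0; rewrite scale0r.
  by move=> _ _ [c ->] [d ->]; exists (c + d); rewrite scalerDl.
by move=> b _ [c ->]; exists (b * c); rewrite scalerA.
Qed.

Section Pack.
Variables (S : set V) (Ssub : submodule S).

Definition packed of submodule S : {pred V} := fun u => `[< S u >].

Fact packed_closed : GRing.subsemimod_closed (packed Ssub).
Proof.
case: (Ssub) => S0 SD SZ; split; first split; first exact/asboolP.
  by move=> u v /asboolP Su /asboolP Sv; apply/asboolP/SD.
by move=> c u /asboolP Su; apply/asboolP/SZ.
Qed.

HB.instance Definition _ := GRing.isSubmodClosed.Build R V (packed Ssub)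
  packed_closed.

Lemma packedP u : reflect (S u) (u \in packed Ssub).
Proof. exact: asboolP. Qed.

End Pack.

Lemma spanP (N : set V) S v :
  submodule N -> S `<=` N -> v \in Defs.span S -> N v.
Proof.
move=> Nsub SN Sv; apply/(packedP Nsub); apply: (span_min _ Sv) => y Sy.
exact/packedP/SN.
Qed.

(** Avoiding a fixed set [T] passes to unions of chains.  With [T] a singleton
    this yields monolithic quotients and maximal submodules, with [T] the
    nonzero elements of a submodule it yields complements in the sense of
    essential extensions. *)
Lemma max_submodule_avoiding N (T : set V) : submodule N -> N `&` T = set0 ->
  exists Z, [/\ submodule Z, N `<=` Z, Z `&` T = set0 &
    forall Z', submodule Z' -> Z `<=` Z' -> Z' `&` T = set0 -> Z' `<=` Z].
Proof.
move=> Nsub NT.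
pose good Z := [/\ submodule Z, N `<=` Z & Z `&` T = set0].
(* The empty set is included: it is the union of the empty chain. *)
have [|Z [PZ maxZ]] := @Zorn_bigcup V [set Z | Z = set0 \/ good Z].
  move=> F FP Ftot /=.
  have [[X0 [FX0 gX0]]|noX] := pselect (exists X, F X /\ good X); last first.
    left; apply/seteqP; split=> // v [X FX Xv].
    by case: (FP _ FX) => [X0|gX]; [rewrite X0 in Xv | case: noX; exists X].
  have gF X v : F X -> X v -> good X.
    by move=> FX Xv; case: (FP _ FX) => // X0'; rewrite X0' in Xv.
  right; split.
  - split; first by exists X0 => //; case: gX0 => -[].
    + move=> u v [X FX Xu] [Y FY Yv].
      have [XY|YX] := Ftot _ _ FX FY.
        by exists Y => //; have [[_ YD _] _ _] := gF _ _ FY Yv; apply/YD/Yv/XY.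
      by exists X => //; have [[_ XD _] _ _] := gF _ _ FX Xu; apply/XD/YX.
    + move=> c u [X FX Xu]; exists X => //.
      by have [[_ _ XZ] _ _] := gF _ _ FX Xu; apply: XZ.
  - by move=> v Nv; exists X0 => //; case: gX0 => _ NX0 _; apply: NX0.
  - apply/seteqP; split=> // v [[X FX Xv] Tv].
    by have [_ _ <-] := gF _ _ FX Xv.
have gZ : good Z.
  case: PZ => // Z0; case: (maxZ N); last by right; split.
  by rewrite Z0; split=> // /(_ 0); apply; case: Nsub.
exists Z; case: gZ => Zsub NZ ZT; split=> // Z' Z'sub ZZ' Z'T v Z'v.
apply: contrapT => nZv; apply: (maxZ Z'); last first.
  by right; split=> // u /NZ/ZZ'.
by split=> // Z'Z; apply/nZv/Z'Z.
Qed.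

(** Modulo [Z], every nonzero submodule contains [y]. *)
Lemma max_submodule_avoiding1 N y : submodule N -> ~ N y ->
  exists Z, [/\ submodule Z, N `<=` Z, ~ Z y &
    forall v, ~ Z v -> exists c, Z (c *: v - y)].
Proof.
move=> Nsub nNy.
have [|Z [Zsub NZ Zy maxZ]] := @max_submodule_avoiding N [set y] Nsub.
  by apply/seteqP; split=> // u [Nu /= uy]; rewrite uy in Nu.
exists Z; split=> //.
  by move=> Zy'; have : (Z `&` [set y]) y by []; rewrite Zy.
move=> v nZv; apply: contrapT => noc; apply: nZv.
have Lsub := submodule_add Zsub (submodule_line v).
case: (Zsub) => Z0 ZD ZZ.
apply: (maxZ _ Lsub).
- move=> u Zu; exists u, 0.
  by split; rewrite ?addr0 //; case: (submodule_line v).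
- apply/seteqP; split=> // w [[u [_ [Zu [c ->] ->]]] /= yE].
  case: noc; exists c; rewrite -yE opprD addrCA subrr addr0 -scaleN1r.
  exact: ZZ.
- by exists 0, v; split; rewrite ?add0r //; exists 1; rewrite scale1r.
Qed.

Definition nilp x : set V := [set v : V | exists n, x ^+ n *: v = 0].

Lemma nilp_leq x (v : V) m n : (m <= n)%N -> x ^+ m *: v = 0 -> x ^+ n *: v = 0.
Proof. by move=> mn xv; rewrite -(subnK mn) exprD -scalerA xv scaler0. Qed.

Lemma submodule_nilp x : submodule (nilp x).
Proof.
split; first by exists 0%N; rewrite scaler0.
  move=> u v [m mu] [n nv]; exists (m + n)%N.
  rewrite scalerDr (nilp_leq _ mu) ?leq_addr //.
  by rewrite (nilp_leq _ nv) ?leq_addl ?addr0.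
by move=> c u [n nu]; exists n; rewrite scalerC nu scaler0.
Qed.

Lemma nilp_scale x v : nilp x (x *: v) -> nilp x v.
Proof. by move=> [n xv]; exists n.+1; rewrite exprSr -scalerA. Qed.

End PropSubmodules.

Lemma submodule_preim (R : comPzRingType) (V W : lmodType R)
    (f : {linear V -> W}) (S : set W) :
  submodule S -> submodule [set v | S (f v)].
Proof.
move=> [S0 SD SZ]; split => /=; first by rewrite linear0.
  by move=> u v Su Sv; rewrite linearD; apply: SD.
by move=> c u Su; rewrite linearZ; apply: SZ.
Qed.

Lemma submodule_im (R : comPzRingType) (V W : lmodType R)
    (f : {linear V -> W}) (S : set V) :
  submodule S -> submodule (f @` S).
Proof.
move=> [S0 SD SZ]; split => /=; first by exists 0; rewrite ?linear0.
  move=> _ _ [u Su <-] [v Sv <-]; exists (u + v); rewrite ?linearD //.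
  exact: SD.
by move=> c _ [u Su <-]; exists (c *: u); rewrite ?linearZ //; apply: SZ.
Qed.

Lemma submodule_colon (R : comPzRingType) (V : lmodType R) (S : set V) v :
  submodule S -> submodule [set c : R^o | S (c *: v)].
Proof.
move=> [S0 SD SZ]; split=> [|c d Sc Sd|b c Sc]; rewrite /mkset.
- by rewrite scale0r.
- by rewrite scalerDl; apply: SD.
- by rewrite -[(b *: c) *: _]scalerA; apply: SZ.
Qed.

(** * Noetherian rings and nilpotent action *)

Section Noetherian.
Variables (R : comPzRingType) (noethR : noetherian R).

Lemma ideal_generators (J : set R^o) : submodule J ->
  exists s : seq R, (forall t, t \in s -> J t) /\
    forall N : set R^o, submodule N -> (forall t, t \in s -> N t) -> J `<=` N.
Proof.
move=> Jsub; have [s Js] := noethR (packed Jsub).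
exists s; split=> [t ts|N Nsub sN t Jt].
  by apply/(packedP Jsub); rewrite Js; apply: mem_span.
have : t \in packed Jsub by apply/packedP.
by rewrite Js; apply: spanP.
Qed.

Lemma ideal_chain_stable (J : nat -> set R^o) :
  (forall n, submodule (J n)) -> (forall n, J n `<=` J n.+1) ->
  exists n, J n.+1 `<=` J n.
Proof.
move=> Jsub JS.
have Jle m n : (m <= n)%N -> J m `<=` J n.
  by move/subnK<-; elim: (n - m)%N => [|k IH] //= t /IH; apply: JS.
have Usub : submodule (\bigcup_n J n).
  split; first by exists 0%N => //; case: (Jsub 0%N).
    move=> u v [m _ Ju] [n _ Jv]; exists (m + n)%N => //.
    by case: (Jsub (m + n)%N) => _ + _; apply;
      [apply: Jle Ju; rewrite leq_addr | apply: Jle Jv; rewrite leq_addl].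
  by move=> c u [m _ Ju]; exists m => //; case: (Jsub m) => _ _; apply.
have [s [sU gen]] := ideal_generators Usub.
suff [n sn] : exists n, forall t, t \in s -> J n t.
  by exists n => t Jt; apply: (gen _ (Jsub n) sn); exists n.+1.
elim: s sU {gen} => [|t s IH] sU; first by exists 0%N.
have [n sn] : exists n, forall t, t \in s -> J n t.
  by apply: IH => u us; apply: sU; rewrite inE us orbT.
have [m _ tm] := sU t (mem_head _ _).
exists (m + n)%N => u; rewrite inE => /predU1P[->|/sn].
  by apply: Jle tm; rewrite leq_addr.
by apply: Jle; rewrite leq_addl.
Qed.

(** The annihilators of the [x ^+ k *: v] modulo [Z] increase with [k], so they
    stabilise.  Hence if [x ^+ k *: v] is not in [Z], no multiple of it outside
    [Z] is killed by [x] modulo [Z]: this replaces the Artin-Rees lemma in the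
    study of essential extensions of torsion modules. *)
Lemma ann_power_stable (V : lmodType R) (Z : set V) (x : R) (v : V) :
  submodule Z ->
  exists k, forall c, Z (c *: (x ^+ k.+1 *: v)) -> Z (c *: (x ^+ k *: v)).
Proof.
move=> Zsub; have [_ _ ZZ] := Zsub.
have [k|k c /=|k kP] :=
  @ideal_chain_stable (fun k => [set c | Z (c *: (x ^+ k *: v))]).
- exact: submodule_colon.
- by move=> Zc; rewrite exprS -scalerA scalerC; apply: ZZ.
- by exists k => c; apply: kP.
Qed.

End Noetherian.

Lemma nilp_linear (R : comPzRingType) (V W : lmodType R)
    (f : {linear V -> W}) x v : nilp x v -> nilp x (f v).
Proof. by move=> [n xn]; exists n; rewrite -linearZZ xn linear0. Qed.

Lemma nilp_pair (R : comPzRingType) (V W : lmodType R) x (u : V) (v : W) :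
  nilp x (u, v) <-> nilp x u /\ nilp x v.
Proof.
split=> [[n [xu xv]]|[[m xu] [n xv]]]; first by split; exists n.
exists (m + n)%N; congr pair => /=; first exact: nilp_leq (leq_addr _ _) xu.
exact: nilp_leq (leq_addl _ _) xv.
Qed.

Definition nilps (R : comPzRingType) (s : seq R) (V : lmodType R) : set V :=
  [set v | forall x, x \in s -> nilp x v].
Arguments nilps {R} s V _.

Lemma submodule_nilps (R : comPzRingType) (s : seq R) (V : lmodType R) :
  submodule (nilps s V).
Proof.
split=> [y _|u v su sv y ys|c u su y ys]; case: (submodule_nilp V y) => //.
  by move=> _ + _; apply; [apply: su | apply: sv].
by move=> _ _; apply; apply: su.
Qed.

(** * Artinian modules *)

Section Artinian.
Variables (R : comPzRingType) (V : lmodType R).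
Implicit Types (N : set V) (x : R).

Definition artinian N : Prop := forall P : nat -> set V,
  (forall j, submodule (P j)) -> (forall j, P j.+1 `<=` P j) -> P 0%N `<=` N ->
  exists J, forall j, P J `<=` P j.

Lemma chain_decr (P : nat -> set V) m n :
  (forall j, P j.+1 `<=` P j) -> (m <= n)%N -> P n `<=` P m.
Proof.
by move=> PS /subnK<-; elim: (n - m)%N => [|k IH] //= t /PS; apply: IH.
Qed.

(** Melkersson's criterion for one element.  If [P] is contained in [P'] and
    both have the same submodules [x ^+ n (0 :_P x ^+ n.+1)] of the kernel of [x] for
    all [n], then they are equal, just as comparable ideals of polynomials with
    the same leading coefficients in each degree are.  As in Hilbert's basis
    theorem, such doubly decreasing families stabilise. *)
Lemma artinian_killed N x : submodule N -> N `<=` nilp x ->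
  artinian [set v | N v /\ x *: v = 0] -> artinian N.
Proof.
move=> Nsub Nnil art P Psub PS P0N.
pose L n j :=
  [set w | exists p, [/\ P j p, x ^+ n.+1 *: p = 0 & w = x ^+ n *: p]].
have Lsub n j : submodule (L n j).
  have [P0 PD PZ] := Psub j; split; first by exists 0; rewrite !scaler0.
    move=> _ _ [p [Pp xp ->]] [q [Pq xq ->]]; exists (p + q).
    by rewrite !scalerDr xp xq addr0; split=> //; apply: PD.
  move=> c _ [p [Pp xp ->]]; exists (c *: p).
  by rewrite ![_ *: (c *: p)]scalerC xp scaler0; split=> //; apply: PZ.
have LSl n j : L n.+1 j `<=` L n j.
  move=> _ [p [Pp xp ->]]; exists (x *: p); rewrite !scalerA -!exprSr.
  by split=> //; case: (Psub j) => _ _; apply.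
have LSr n j : L n j.+1 `<=` L n j.
  by move=> _ [p [Pp xp ->]]; exists p; split=> //; apply: PS.
have Ll m n j : (m <= n)%N -> L n j `<=` L m j by apply: (@chain_decr (L^~ j)).
have Lr n i j : (i <= j)%N -> L n j `<=` L n i by apply: (@chain_decr (L n)).
have LN n : L n 0%N `<=` [set v | N v /\ x *: v = 0].
  move=> _ [p [Pp xp ->]]; rewrite /= scalerA -exprS; split=> //.
  by case: Nsub => _ _; apply; apply: P0N.
(* The diagonal controls all rows from the e-th on; finitely many remain. *)
have [e eP] : exists e, forall j, L e e `<=` L j j.
  apply: (art (fun j => L j j)) => //.
  by move=> j; apply: (subset_trans (@LSl j j.+1)).
have [J0 J0P] : exists J, forall n, (n < e)%N -> forall j, L n J `<=` L n j.
  elim: {eP} e => [|e [J1 J1P]]; first by exists 0%N.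
  have [J2 J2P] : exists J, forall j, L e J `<=` L e j
    by apply: (art (L e) _ _ (LN e)).
  exists (J1 + J2)%N => n; rewrite ltnS leq_eqVlt => /predU1P[->|ne] j.
    by apply: subset_trans (J2P j); apply: Lr; rewrite leq_addl.
  by apply: subset_trans (J1P n ne j); apply: Lr; rewrite leq_addr.
pose J := (J0 + e)%N.
have JP n j : L n J `<=` L n j.
  have [ne|en] := ltnP n e.
    by apply: subset_trans (J0P n ne j); apply: Lr; rewrite leq_addr.
  apply: (@subset_trans _ (L e e)).
    by apply: (subset_trans (Ll _ _ _ en)); apply: Lr; rewrite leq_addl.
  apply: (subset_trans (eP (n + j)%N)).
  by apply: (@subset_trans _ (L n (n + j)%N)); [apply: Ll; rewrite leq_addr|
    apply: Lr; rewrite leq_addl].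
exists J => j.
suff jP i : (J <= i)%N -> P J `<=` P i.
  have [/jP//|/ltnW jJ] := leqP J j; exact: (chain_decr PS jJ).
move=> {j} Ji v PJv; have [k] := Nnil _ (P0N _ (chain_decr PS (leq0n J) PJv)).
elim: k v PJv => [|k IH] v PJv xv.
  by rewrite -[v]scale1r -[1](expr0 x) xv; case: (Psub i).
have /JP-/(_ i) [p [Pip _ vp]] : L k J (x ^+ k *: v) by exists v.
have PJp : P J p by apply: (chain_decr PS Ji).
rewrite -[v](subrK p); case: (Psub i) => _ + _; apply=> //.
by apply: IH; [apply: submodule_sub | rewrite scalerBr vp subrr].
Qed.

(** The annihilator [m] of [y] is generated by finitely many [t], each of which
    acts nilpotently: otherwise [y] would be a multiple of [t ^+ k *: v] killed
    by [t], for [k] as in [ann_power_stable].  The elements killed by [m]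
    are the multiples of [y], and they form a simple module, which is Artinian;
    [artinian_killed] then removes the conditions [t *: v = 0] one by one. *)
Lemma monolithic_artinian (noethR : noetherian R) (y : V) :
  y != 0 -> (forall v, v != 0 -> exists c, c *: v = y) -> artinian setT.
Proof.
move=> y0 mono.
have msub (v : V) : submodule [set c : R^o | c *: v = 0].
  exact: submodule_colon (submodule0 V).
have [s [sm gen]] := ideal_generators noethR (msub y).
have snil t (v : V) : t \in s -> nilp t v.
  move=> /sm /= ty; have [k kP] := ann_power_stable noethR t v (submodule0 V).
  exists k; apply: contrapT => /eqP /mono[c cy].
  move: y0; rewrite -cy; case/eqP; apply: kP => /=.
  by rewrite exprS -scalerA scalerC cy.
have sart : artinian [set v | forall t, t \in s -> t *: v = 0].
  move=> P Psub PS P0; have [yP|/existsNP[J yJ]] := pselect (forall j, P j y).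
    exists 0%N => j v P0v; have [->|/mono[c cv]] := eqVneq v 0.
      by case: (Psub j).
    have /mono[d dcy] : c *: y != 0.
      apply: contra_neq y0 => cy; rewrite -cv.
      exact: (gen _ (msub v) (P0 _ P0v)).
    have : (1 - d * c) *: v = 0.
      apply: (gen _ (msub v) (P0 _ P0v)); rewrite /= scalerBl scale1r -scalerA.
      by rewrite dcy subrr.
    rewrite scalerBl scale1r -scalerA cv => /subr0_eq ->.
    by case: (Psub j) => _ _; apply.
  exists J => j v PJv; have [->|/mono[c cv]] := eqVneq v 0.
    by case: (Psub j).
  by case: yJ; rewrite -cv; case: (Psub J) => _ _; apply.
elim: s snil sart {sm gen} => [|t s IH] snil sart.
  by move=> P Psub PS _; apply: sart.
apply: IH => [u v us|]; first by apply: snil; rewrite inE us orbT.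
apply: (@artinian_killed _ t).
- split=> [u _|u v su sv r rs|c u su r rs]; rewrite ?scaler0 //.
    by rewrite scalerDr su ?sv ?addr0.
  by rewrite scalerC su ?scaler0.
- by move=> v _; apply: snil; rewrite mem_head.
- move=> P Psub PS P0; apply: sart => // v /P0[sv tv] u.
  by rewrite inE => /predU1P[->|/sv].
Qed.

End Artinian.

(** * Coatomic modules *)

Section Coatomic.
Variables (R : comPzRingType) (V : lmodType R).
Hypothesis coatV : coatomic V.
Variables (x : R) (xnil : forall v : V, nilp x v).

(** A maximal submodule [P] contains every [x *: v]: otherwise [x] would be
    injective on the simple quotient, where it is nilpotent.  So no proper
    submodule [N] can satisfy [N + x V = V]. *)
Lemma coatomic_small (N : set V) : submodule N ->
  (forall u, exists v, N (u - x *: v)) -> forall u, N u.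
Proof.
move=> Nsub Nx u; apply: contrapT => nNu.
have [|P [[w Pw] Pmax] NP] := coatV (N := packed Nsub).
  by exists u; apply/packedP.
have P'sub := submodule_preim (GRing.scale x) (submodule_closed P).
have [xP|] := pselect (forall v, x *: v \in P).
  have [v /(packedP Nsub) /NP Pwv] := Nx w.
  by move/negP: Pw; apply; rewrite -[w](subrK (x *: v)) rpredD.
move=> /existsNP[v xv].
have P'P : {subset packed P'sub <= P}.
  apply: Pmax; first by exists v; apply/packedP.
  by move=> p Pp; apply/packedP; rewrite /= rpredZ.
have xnP n : x ^+ n *: w \in P -> w \in P.
  elim: n => [|n IH]; first by rewrite scale1r.
  by rewrite exprS -scalerA => ?; apply: IH; apply: P'P; apply/packedP.
have [n xn] := xnil w; move/negP: Pw; apply.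
by apply: (xnP n); rewrite xn rpred0.
Qed.

(** Nakayama's lemma for all subquotients of [V].  In the monolithic Artinian
    quotient [Q], the chain of the [x ^+ n Q] stabilises at some [e], so that
    [Q] is the sum of [x Q] and of the kernel of [x ^+ e]; by
    [coatomic_small] this kernel is everything.  But [x ^+ e Q] contains the
    image of [y], as [A] is contained in [x ^+ e A + B]. *)
Lemma coatomic_nakayama (noethR : noetherian R) (A B : set V) :
  submodule A -> submodule B ->
  (forall u, A u -> exists2 v, A v & B (u - x *: v)) -> A `<=` B.
Proof.
move=> Asub Bsub ABx y Ay; apply: contrapT => nBy.
have [Z [Zsub BZ nZy Zmax]] := max_submodule_avoiding1 Bsub nBy.
pose Q : lmodType R := quot_module (packed Zsub).
pose pi : {linear V -> Q} := quot_proj (packed Zsub).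
have piE u v : pi u = pi v <-> Z (u - v).
  by split=> [/quot_proj_eq/packedP //|Zuv]; apply/quot_proj_eq/packedP.
have pi0 u : pi u = 0 <-> Z u by rewrite -(linear0 pi) piE subr0.
have piS (q : Q) : exists v, pi v = q := quot_proj_surj q.
clearbody pi; clearbody Q.
have y0 : pi y != 0 by apply/eqP => /pi0.
have art : artinian [set: Q].
  apply: (monolithic_artinian noethR y0) => q; have [v <-] := piS q => v0.
  have [|c Zc] := Zmax v; first by move/pi0 => v0'; rewrite v0' eqxx in v0.
  by exists c; rewrite -linearZZ; apply/piE.
pose P n := [set q : Q | exists r, q = x ^+ n *: r].
have Psub n : submodule (P n).
  split=> [|_ _ [p ->] [q ->]|c _ [p ->]]; first by exists 0; rewrite scaler0.
    by exists (p + q); rewrite scalerDr.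
  by exists (c *: p); rewrite scalerC.
have [|//|e eP] := art P Psub.
  by move=> n _ [q ->]; exists (x *: q); rewrite exprSr scalerA.
have Ksub : submodule [set v | x ^+ e *: pi v = 0].
  split=> /= [|u v xu xv|c u xu]; first by rewrite linear0 scaler0.
    by rewrite linearD scalerDr xu xv addr0.
  by rewrite linearZZ scalerC xu scaler0.
have xe0 u : x ^+ e *: pi u = 0.
  apply: (coatomic_small Ksub) => {}u.
  have [|r xr] := eP e.+1 (x ^+ e *: pi u); first by exists (pi u).
  have [v vr] := piS r; exists v.
  by rewrite /= (linearB pi) scalerBr xr (linearZZ pi) vr exprSr scalerA subrr.
have [v Av yv] : exists2 v, A v & Z (y - x ^+ e *: v).
  elim: (e) => [|n [v Av Zv]].
    by exists y; rewrite // scale1r subrr -pi0 linear0.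
  have [w Aw /BZ Zw] := ABx v Av; exists w => //.
  rewrite -(subrK (x ^+ n *: v) y) -addrA exprSr -scalerA -scalerBr.
  by case: Zsub => _ ZD ZZ; apply: ZD => //; apply: ZZ.
have /piE yE := yv.
by move: y0; rewrite yE (linearZZ pi) xe0 eqxx.
Qed.

End Coatomic.

Section FinitelyGenerated.
Variables (R : comPzRingType) (V : lmodType R).

(** Add the generators to [N] one at a time as long as the sum stays proper; at
    the first generator [y] for which it does not, a submodule maximal without
    [y] is maximal. *)
Lemma finitely_generated_coatomic : finitely_generated V -> coatomic V.
Proof.
move=> [s sV] N [w Nw].
have {sV} gen N' :
  submodule N' -> (forall t, t \in s -> N' t) -> forall v, N' v.
  by move=> N'sub sN' v; apply: (spanP N'sub _ (sV v)).
suff [P [Psub [v Pv] NP Pmax]] : exists P : set V, [/\ submodule P,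
    exists v, ~ P v, [set u | u \in N] `<=` P & forall P', submodule P' ->
    P `<=` P' -> (exists v, ~ P' v) -> P' `<=` P].
  exists (packed Psub : submodClosed V); last by move=> u /NP Pu; apply/packedP.
  split; first by exists v; apply/packedP.
  move=> P' [v' /negP P'v'] PP' u P'u; apply/packedP.
  apply: (Pmax _ (submodule_closed P')) => //; last by exists v'.
  by move=> t /(packedP Psub)/PP'.
move: (submodule_closed N) => Nsub.
have {Nw} : exists v, ~ [set u | u \in N] v by exists w; apply/negP.
have {gen} : forall N', submodule N' -> [set u | u \in N] `<=` N' ->
    (forall t, t \in s -> N' t) -> forall v, N' v.
  by move=> N' N'sub _; apply: gen.
move: [set u | u \in N] Nsub; elim: s => [|y s IH] {w}N' N'sub gen [w nw].
  by case: nw; apply: (gen N').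
have [N10 N1D N1Z] := submodule_add N'sub (submodule_line y).
set N1 := addset N' (line y) in N10 N1D N1Z.
have N'N1 : N' `<=` N1.
  move=> u Nu; exists u, 0; rewrite addr0; split=> //.
  by case: (submodule_line y).
have N1y : N1 y.
  exists 0, y; rewrite add0r; split=> //; first by case: N'sub.
  by exists 1; rewrite scale1r.
have N1min P : submodule P -> N' `<=` P -> P y -> N1 `<=` P.
  move=> [P0 PD PZ] NP Py _ [u [_ [Nu [c ->] ->]]].
  by apply: PD; [apply: NP | apply: PZ].
have [N1T|/existsNP N1proper] := pselect (forall v, N1 v); last first.
  have [//|N2 N2sub N1N2 sN2|P [Psub Pproper NP Pmax]] := IH N1 _ _ N1proper.
    apply: gen => // [u Nu|t]; first exact/N1N2/N'N1.
    by rewrite inE => /predU1P[->|/sN2 //]; apply: N1N2.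
  by exists P; split=> // u /N'N1/NP.
have nNy : ~ N' y by move=> Ny; apply/nw/(N1min _ N'sub).
have [Z [Zsub NZ nZy Zmax]] := max_submodule_avoiding1 N'sub nNy.
exists Z; split=> //; first by exists y.
move=> P Psub ZP [v nPv] u Pu; apply: contrapT => nZu.
have [c Zc] := Zmax u nZu; apply/nPv/(N1min P) => //.
  by move=> t /NZ/ZP.
rewrite -[y](subKr (c *: u)); apply: submodule_sub => //; last exact: ZP.
by case: Psub => _ _; apply.
Qed.

End FinitelyGenerated.

(** * Torsion in injective modules *)

Section Injective.
Variable R : comPzRingType.
Implicit Types V W : lmodType R.

Lemma injective_pair V W :
  injective_module V -> injective_module W -> injective_module (V * W)%type.
Proof.
move=> Vinj Winj A B f g finj.
have [h1 h1P] := Vinj A B f (fst \o g) finj.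
have [h2 h2P] := Winj A B f (snd \o g) finj.
have hlin : linear (fun b => (h1 b, h2 b)).
  by move=> c u v; rewrite !linearP.
pose hL := GRing.isLinear.Build R B (V * W)%type _ _ hlin.
pose h : {linear B -> (V * W)%type} := HB.pack (fun b => (h1 b, h2 b)) hL.
by exists h => a; rewrite /= h1P h2P /=; case: (g a).
Qed.

(** [P] is a direct summand.  Inside an injective module this says that [P] is
    injective, without turning [P] into a type. *)
Definition retract V (P : set V) : Prop :=
  exists rho : {linear V -> V},
    (forall v, P (rho v)) /\ forall v, P v -> rho v = v.

Lemma retract_submodule V (P : set V) : retract P -> submodule P.
Proof.
move=> [rho [Prho rhoK]]; split; first by rewrite -(linear0 rho).
  by move=> u v /rhoK <- /rhoK <-; rewrite -linearD.
by move=> c u /rhoK <-; rewrite -linearZZ.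
Qed.

Lemma retract_pair V W (P : set V) (Q : set W) : retract P -> retract Q ->
  retract [set w : V * W | P w.1 /\ Q w.2].
Proof.
move=> [f [Pf fK]] [g [Qg gK]].
have hlin : linear (fun w : V * W => (f w.1, g w.2)).
  by move=> c u v; rewrite !linearP.
pose hL := GRing.isLinear.Build R (V * W)%type (V * W)%type _ _ hlin.
pose h : {linear (V * W)%type -> (V * W)%type} :=
  HB.pack (fun w : V * W => (f w.1, g w.2)) hL.
exists h; split=> [w|[u v] [/= Pu Qv]]; last by rewrite fK // gK.
by split; [apply: Pf | apply: Qg].
Qed.

(** The graph of [c y |-> c w] is a submodule of [R * V]; its first projection
    is injective exactly when the annihilator condition holds.  If [h] on [R]
    extends the second projection, then [y *: h 1 = w]. *)
Lemma injective_divisible V (P : set V) (y : R) (w : V) :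
  injective_module V -> retract P -> P w ->
  (forall c, c * y = 0 -> c *: w = 0) -> exists2 v, P v & y *: v = w.
Proof.
move=> Vinj [rho [Prho rhoK]] Pw ann.
have gsub := submodule_line ((y : R^o), w).
pose G := submod (packed gsub).
have finj : injective (fst \o (val : G -> (R^o * V)%type)).
  move=> p q pq1; apply: val_inj; apply: subr0_eq.
  have /packedP[c pqE] := valP (p - q); rewrite linearB /= in pqE.
  have cy : c * y = 0.
    rewrite -[LHS]/((c *: (y : R^o, w)).1) -pqE.
    by move/eqP: pq1; rewrite -subr_eq0 => /eqP.
  by rewrite pqE; congr pair; [exact: cy | exact: ann].
have [h hP] := Vinj G R^o (fst \o val) (snd \o val) finj.
have wG : ((y : R^o), w) \in packed gsub.
  by apply/packedP; exists 1; rewrite scale1r.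
exists (rho (h 1)) => //; rewrite -linearZZ -linearZZ.
have := hP (exist (fun u => u \in packed gsub) _ wG : G).
rewrite /= /GRing.scale /= mulr1 => ->.
exact: rhoK.
Qed.

End Injective.

Section InjectiveTorsion.
Variables (R : comPzRingType) (noethR : noetherian R).
Variables (V : lmodType R) (Vinj : injective_module V).

(** Let [Z] be maximal with zero intersection with the torsion [G].  Then
    [V / Z] is an essential extension of [G], hence is itself [x]-torsion by
    [ann_power_stable], and the inclusion of [G] into [V] extends to it. *)
Lemma retract_nilp x : retract (nilp x : set V).
Proof.
have Gsub := submodule_nilp V x.
have [|Z [Zsub _ ZG Zmax]] :=
    @max_submodule_avoiding R V [set 0] [set v | nilp x v /\ v <> 0]
      (submodule0 V).
  by apply/seteqP; split=> // v [/= -> []].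
have ZG0 v : Z v -> nilp x v -> v = 0.
  move=> Zv Gv; apply: contrapT => v0.
  by have : (Z `&` [set v | nilp x v /\ v <> 0]) v by []; rewrite ZG.
have ess v : exists n, Z (x ^+ n *: v).
  have [k kP] := ann_power_stable noethR x v Zsub.
  exists k; apply: contrapT => nZ; apply: nZ.
  set u := x ^+ k *: v in kP *.
  have {}kP c : Z (c *: (x *: u)) -> Z (c *: u).
    by move=> Zc; apply: kP; rewrite exprS -scalerA.
  have Lsub := submodule_add Zsub (submodule_line u).
  apply: (Zmax _ Lsub).
  - move=> z Zz; exists z, 0.
    by split; rewrite ?addr0 //; case: (submodule_line u).
  - apply/seteqP; split=> // _ [[z [_ [Zz [c ->] ->]]] [[n xn]] []].
    have cZ i : Z (c *: (x ^+ i *: u)) -> Z (c *: u).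
      elim: i => [|i IH]; first by rewrite scale1r.
      rewrite exprSr -scalerA (scalerA c) => xiu.
      by apply: IH; rewrite scalerA; apply: kP.
    have Zcu : Z (c *: u).
      apply: (cZ n); move/eqP: xn; rewrite scalerDr addr_eq0 => /eqP xn.
      rewrite scalerC -[_ *: _]opprK -xn -scaleN1r.
      by have [_ _ sZ] := Zsub; apply: (sZ); apply: (sZ).
    by apply: ZG0; [case: Zsub => _ + _; apply | exists n].
  - exists 0, u; split; rewrite ?add0r //; first by case: Zsub.
    by exists 1; rewrite scale1r.
pose Q : lmodType R := quot_module (packed Zsub).
pose pi : {linear V -> Q} := quot_proj (packed Zsub).
pose G : lmodType R := submod (packed Gsub).
have iinj : injective (pi \o (val : G -> V)).
  move=> g h /quot_proj_eq/packedP Zgh; apply/val_inj/subr0_eq/ZG0 => //.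
  by rewrite -linearB; apply/(packedP Gsub); apply: valP.
have [h hP] := @Vinj G Q (pi \o val) val iinj.
exists (h \o pi); split=> [v|v Gv].
  have [n Zn] := ess v; exists n.
  rewrite /= -!linearZZ; rewrite (_ : pi _ = 0) ?linear0 //.
  by rewrite -(linear0 pi); apply/quot_proj_eq/packedP; rewrite subr0.
have /packedP vG := Gv.
exact: (hP (exist (fun u => u \in packed Gsub) _ (vG Gsub) : G)).
Qed.

(** Multiplication by [x] is surjective modulo [x]-torsion: once the
    annihilators of the powers of [x] are stable, [x ^+ k *: q] is a multiple of
    [x ^+ k.+1] by injectivity. *)
Lemma nilp_divisible (P : set V) x q : retract P -> P q ->
  exists2 t, P t & nilp x (q - x *: t).
Proof.
move=> Pret Pq.
have [k kP] := ann_power_stable noethR x (1 : R^o) (submodule0 _).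
have [|c cx|t Pt tP] :=
  @injective_divisible R V P (x ^+ k.+1) (x ^+ k *: q) Vinj Pret.
- by case: (retract_submodule Pret) => _ _; apply.
- have cxk : c * x ^+ k = 0.
    by have := kP c; rewrite /= /GRing.scale /= !mulr1 => /(_ cx).
  by rewrite scalerA cxk scale0r.
by exists t => //; exists k; rewrite scalerBr scalerA -exprSr tP subrr.
Qed.

End InjectiveTorsion.

Lemma retract_torsion (R : comPzRingType) (V : lmodType R) (P : set V) x :
  retract P -> retract (nilp x : set V) -> retract (P `&` nilp x).
Proof.
move=> [rho [Prho rhoK]] [sig [Gsig sigK]]; exists (rho \o sig); split=> v /=.
  split; first exact: Prho.
  by have [n xn] := Gsig v; exists n; rewrite -linearZZ xn linear0.
by move=> [Pv Gv]; rewrite sigK ?rhoK.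
Qed.

(** * Nakayama's lemma for subquotients *)

Section Nakayama.
Variable R : comPzRingType.
Implicit Types V : lmodType R.

(** For the subquotient [Z / B] of [V]: no nonzero subquotient [(A + A0) / A0]
    of it is equal to its multiple by [x]. *)
Definition nakayama V (x : R) (Z B : set V) : Prop :=
  forall A A0 : set V, submodule A -> submodule A0 -> A `<=` Z -> B `<=` A0 ->
  (forall u, A u -> exists2 v, A v & A0 (u - x *: v)) -> A `<=` A0.

(** [Z / B] is an extension of a submodule of [Z2 / B2] by a quotient of
    [Z1 / B1].  The image of a subquotient [Y] with [x Y = Y] in [Z2 / B2] is
    zero, so [Y] comes from [Z1 / B1] and is zero as well. *)
Lemma nakayama_exact V1 V V2 (f : {linear V1 -> V}) (g : {linear V -> V2})
    x (Z1 B1 : set V1) (Z B : set V) (Z2 B2 : set V2) :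
  submodule Z1 -> submodule Z -> submodule B2 -> B `<=` Z ->
  (forall v, B1 v -> B (f v)) -> (forall v, Z v -> Z2 (g v)) ->
  (forall v, Z v -> B2 (g v) -> exists2 v1, Z1 v1 & B (v - f v1)) ->
  nakayama x Z1 B1 -> nakayama x Z2 B2 -> nakayama x Z B.
Proof.
move=> Z1sub Zsub B2sub BZ fB gZ exct nak1 nak2 A A0 Asub A0sub AZ BA0 AxA0.
pose A1 := A0 `&` Z; have A1sub : submodule A1 by apply: submoduleI.
have [A1_0 A1D A1Z] := A1sub.
have BA1 : B `<=` A1 by move=> b Bb; split; [apply: BA0 | apply: BZ].
have AxA1 u : A u -> exists2 v, A v & A1 (u - x *: v).
  move=> Au; have [v Av A0v] := AxA0 u Au; exists v => //; split=> //.
  apply: submodule_sub => //; first exact: AZ.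
  by case: Zsub => _ _; apply; apply: AZ.
have gA : g @` A `<=` addset (g @` A1) B2.
  apply: nak2.
  - exact: submodule_im.
  - by apply: submodule_add => //; apply: submodule_im.
  - by move=> _ [u Au <-]; apply/gZ/AZ.
  - move=> b B2b; exists 0, b; rewrite add0r; split=> //.
    by exists 0; rewrite ?linear0.
  - move=> _ [u Au <-]; have [v Av A1v] := AxA1 u Au.
    exists (g v); first by exists v.
    exists (g (u - x *: v)), 0; rewrite addr0; split.
      by exists (u - x *: v).
      by case: B2sub.
    by rewrite (linearB g) (linearZZ g).
have split_A u : A u -> exists b v1, [/\ A1 b, Z1 v1 & u = b + f v1].
  move=> Au; have [|_ [c [[b A1b <-] B2c e]]] := gA (g u); first by exists u.
  have [||v1 Z1v1 Bv] := exct (u - b).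
  - by apply: submodule_sub => //; [apply: AZ | case: A1b].
  - by rewrite (linearB g) e addrC addKr.
  exists (b + (u - b - f v1)), v1; split=> //.
    by apply: A1D => //; apply: BA1.
  by rewrite -!addrA addNr addr0 addrC subrK.
pose A' := Z1 `&` [set v | addset A A1 (f v)].
have A'A1 : A' `<=` [set v | A1 (f v)].
  apply: nak1.
  - by apply: submoduleI => //; apply: submodule_preim; apply: submodule_add.
  - exact: submodule_preim.
  - by move=> v [].
  - by move=> v B1v; apply/BA1/fB.
  - move=> v [Z1v [u [b [Au A1b e]]]].
    have [w Aw A1w] := AxA1 u Au; have [b' [v' [A1b' Z1v' e']]] := split_A w Aw.
    exists v'.
      split=> //; exists w, (- b'); rewrite e'; split; first by rewrite -e'.
        by rewrite -scaleN1r; apply: A1Z.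
      by rewrite addrAC subrr add0r.
    rewrite /= (linearB f) (linearZZ f) e.
    have -> : f v' = w - b' by rewrite e' addrAC subrr add0r.
    rewrite scalerBr opprB [x *: b' - _]addrC addrACA.
    by apply: (A1D) => //; apply: (A1D) => //; apply: A1Z.
move=> u Au; have [b [v [A1b Z1v e]]] := split_A u Au.
suff [A0u _] : A1 u by [].
rewrite e; apply: A1D => //; apply: A'A1; split=> //.
exists u, (- b); rewrite e; split; first by rewrite -e.
  by rewrite -scaleN1r; apply: A1Z.
by rewrite addrAC subrr add0r.
Qed.

End Nakayama.

(** * Cones of multiplication maps *)

Section Cones.
Variables (R : comPzRingType) (noethR : noetherian R).
Implicit Types C : complex R.

(** The mapping cone of multiplication by [x], without its term of degree -1:
    only cohomology in positive degrees is considered below. *)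
Definition cone_obj C i : lmodType R := (C i.+1 * C i)%type.

Definition cone_fun C x i (w : cone_obj C i) : cone_obj C i.+1 :=
  (- cdiff C i.+1 w.1, x *: w.1 + cdiff C i w.2).

Fact cone_linear C x i : linear (@cone_fun C x i).
Proof.
move=> c u v; congr pair; rewrite /= (linearP (cdiff C _)).
  by rewrite opprD scalerN.
by rewrite [in RHS]scalerDr scalerDr (scalerC x c) addrACA.
Qed.
HB.instance Definition _ C x i := GRing.isLinear.Build R (cone_obj C i)
  (cone_obj C i.+1) _ (@cone_fun C x i) (@cone_linear C x i).

Fact cone_cdiff2 C x i w : cone_fun x (@cone_fun C x i w) = 0.
Proof.
rewrite /cone_fun /= (linearN (cdiff C _)) (linearD (cdiff C _)).
rewrite (linearZZ (cdiff C _)) !cdiff_cdiff !oppr0 addr0.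
by rewrite scalerN addNr.
Qed.

Definition cone C x : complex R :=
  @Complex R (cone_obj C) (fun i => @cone_fun C x i) (@cone_cdiff2 C x).

Definition subcomplex C (P : forall i, set (C i)) : Prop :=
  forall i v, P i v -> P i.+1 (cdiff C i v).

Definition cocyc C (P : forall i, set (C i)) i : set (C i) :=
  [set z | P i z /\ cdiff C i z = 0].

Definition cobound C (P : forall i, set (C i)) i : set (C i.+1) :=
  cdiff C i @` P i.

Definition coneP C x (P : forall i, set (C i)) i : set (cone C x i) :=
  [set w : C i.+1 * C i | P i.+1 w.1 /\ P i w.2].

Arguments cocyc {C} P i _.
Arguments cobound {C} P i _.
Arguments coneP {C} x P i _.

Lemma submodule_cocyc C (P : forall i, set (C i)) i :
  submodule (P i) -> submodule (cocyc P i).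
Proof.
move=> Psub; apply: submoduleI => //.
exact: (submodule_preim (cdiff C i) (submodule0 _)).
Qed.

Lemma cobound_cocyc C (P : forall i, set (C i)) i :
  subcomplex P -> cobound P i `<=` cocyc P i.+1.
Proof. by move=> Pcx _ [y Py <-]; split; [apply: Pcx | apply: cdiff_cdiff]. Qed.

Lemma submodule_cone C x (P : forall i, set (C i)) i :
  (forall i, submodule (P i)) -> submodule (coneP x P i).
Proof.
move=> Psub; apply: submoduleI; first exact: (submodule_preim fst).
exact: (submodule_preim snd).
Qed.

Lemma subcomplex_cone C x (P : forall i, set (C i)) :
  (forall i, submodule (P i)) -> subcomplex P -> subcomplex (coneP x P).
Proof.
move=> Psub Pcx j [u v] [/= Pu Pv]; case: (Psub j.+1) => _ PD PZ.
split=> /=; last by apply: PD; [apply: PZ | apply: Pcx].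
by rewrite -scaleN1r; case: (Psub j.+2) => _ _; apply; apply: Pcx.
Qed.

(** By [nakayama_exact], applied to the exact sequence
    [H^i(C) -> H^i(cone x) -> H^(i+1)(C)] of a mapping cone. *)
Lemma nakayama_cone C x t (P : forall i, set (C i)) i :
  (forall i, submodule (P i)) -> subcomplex P ->
  nakayama t (cocyc P i.+1) (cobound P i) ->
  nakayama t (cocyc P i.+2) (cobound P i.+1) ->
  nakayama t (cocyc (coneP x P) i.+1) (cobound (coneP x P) i).
Proof.
move=> Psub Pcx.
have PN j v : P j v -> P j (- v).
  by move=> Pv; rewrite -scaleN1r; case: (Psub j) => _ _; apply.
have inlin : linear (fun v : C i.+1 => (0, v) : cone C x i.+1).
  by move=> c u v; congr pair; rewrite /= scaler0 addr0.
pose inL := GRing.isLinear.Build R (C i.+1) (cone C x i.+1) _ _ inlin.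
pose f : {linear C i.+1 -> cone C x i.+1} :=
  HB.pack (fun v => (0, v) : cone C x i.+1) inL.
pose g : {linear cone C x i.+1 -> C i.+2} := fst.
have [P0 _ PZ] := Psub i.+1.
apply: (@nakayama_exact R _ _ _ f g).
- exact: submodule_cocyc.
- exact/submodule_cocyc/submodule_cone.
- exact: submodule_im.
- exact: (cobound_cocyc (subcomplex_cone Psub Pcx)).
- move=> _ [y Py <-]; exists (0, y); first by split=> //; case: (Psub i.+1).
  by congr pair; rewrite /= ?scaler0 ?add0r // linear0 oppr0.
- move=> [u v] [[/= Pu Pv] [/eqP du _]]; split=> //.
  by apply/eqP; rewrite -oppr_eq0.
- move=> [u v] [[/= Pu Pv] [_ xdv]] [w Pw uE]; rewrite /= in uE.
  exists (v + x *: w).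
    split; first by case: (Psub i.+1) => _ PD _; apply: PD => //; apply: PZ.
    by rewrite linearD linearZZ uE addrC.
  exists (- w, 0); first by split=> /=; [apply: PN | case: (Psub i)].
  congr pair => /=; first by rewrite linearN opprK subr0.
  by rewrite linear0 addr0 opprD addrA subrr add0r scalerN.
Qed.

(** A cocycle of the cone on the [x]-torsion is the coboundary of some
    [(- w, q)] in the cone on [P].  Since [x] is bijective modulo torsion,
    [q] is [x *: t] modulo torsion; subtracting the coboundary of [(t, 0)] makes the
    second component torsion, and then the first one is torsion too. *)
Lemma cone_acyclic C x (P : forall i, set (C i)) :
  (forall i, injective_module (C i)) -> (forall i, retract (P i)) ->
  subcomplex P ->
  (forall i, cocyc P i.+1 `<=` cobound P i) ->
  let Q := coneP x (fun i => P i `&` nilp x) in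
  forall i, cocyc Q i.+1 `<=` cobound Q i.
Proof.
move=> Cinj Pret Pcx Pacyc Q i [u v] [[/= [Pu xu] [Pv xv]] [/eqP du xdv]].
have Psub j := retract_submodule (Pret j).
have Nsub j := submodule_nilp (C j) x.
have [w Pw uE] : cobound P i.+1 u.
  by apply: Pacyc; split=> //; apply/eqP; rewrite -oppr_eq0.
have [q Pq vE] : cobound P i (v + x *: w).
  apply: Pacyc; split.
    by case: (Psub i.+1) => _ PD PZ; apply: PD => //; apply: PZ.
  by rewrite linearD linearZZ uE addrC.
have [t Pt qt] := nilp_divisible noethR (Cinj i) x (Pret i) Pq.
pose q' := q - x *: t; pose p' := cdiff C i t - w.
have vE' : v = x *: p' + cdiff C i q'.
  rewrite /p' /q' (linearB (cdiff C i)) (linearZZ (cdiff C i)) vE scalerBr.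
  by rewrite addrC addrA addrNK addrK.
exists (p', q'); last first.
  congr pair => //=.
  by rewrite /p' (linearB (cdiff C _)) cdiff_cdiff sub0r opprK.
split; last first.
  split=> //; apply: submodule_sub => //.
  by case: (Psub i) => _ _; apply.
split; first by apply: submodule_sub => //; apply: Pcx.
apply: nilp_scale; rewrite (_ : x *: _ = v - cdiff C i q'); last first.
  by rewrite vE' addrK.
by apply: submodule_sub => //; apply: nilp_linear.
Qed.

(** The ambient complex changes along the induction, from [C] with the
    subcomplex [P] to the cone of [x] with the cone on the [x]-torsion of [P];
    the torsion of the latter for the remaining elements is the cone on the
    torsion [T] for all of them.  Vanishing for the cone makes [x]
    surjective on the cohomology of [T]. *)
Lemma torsion_cohomology_vanishing s C (P : forall i, set (C i)) r :
  (forall i, injective_module (C i)) -> (forall i, retract (P i)) ->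
  subcomplex P ->
  (forall i, cocyc P i.+1 `<=` cobound P i) ->
  let T i := P i `&` nilps s (C i) in
  (forall i x, (r <= i)%N -> x \in s ->
     nakayama x (cocyc T i.+1) (cobound T i)) ->
  forall i, (r <= i)%N -> cocyc T i.+1 `<=` cobound T i.
Proof.
elim: s C P => [|x s IH] C P Cinj Pret Pcx Pacyc T nakT i ri.
  have -> : T = P.
    apply: functional_extensionality_dep => j.
    by apply/seteqP; split=> v; [case|split].
  exact: Pacyc.
have Psub j := retract_submodule (Pret j).
have Tsub j : submodule (T j).
  by apply: submoduleI => //; apply: submodule_nilps.
have Tcx : subcomplex T.
  by move=> j v [Pv Tv]; split; [apply: Pcx | move=> y /Tv; apply: nilp_linear].
pose Q := coneP x (fun i => P i `&` nilp x).
have QT : (fun j => Q j `&` nilps s (cone C x j)) = coneP x T.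
  apply: functional_extensionality_dep => j; apply/seteqP.
  split=> -[u v] /=.
    move=> [[[Pu xu] [Pv xv]] suv].
    by split; split=> // y; rewrite inE => /predU1P[->//|/suv /nilp_pair[]].
  move=> [[Pu su] [Pv sv]].
  split; first by split; split=> //; [apply: su | apply: sv]; rewrite mem_head.
  move=> y ys; apply/nilp_pair.
  by split; [apply: su | apply: sv]; rewrite inE ys orbT.
have coneT j : (r <= j)%N -> cocyc (coneP x T) j.+1 `<=` cobound (coneP x T) j.
  rewrite -QT; apply: IH.
  - by move=> k; apply: injective_pair.
  - move=> k; apply: retract_pair; apply: retract_torsion => //;
      exact: retract_nilp.
  - apply: subcomplex_cone => [k|k v [Pv xv]].
      by apply: submoduleI => //; apply: submodule_nilp.
    by split; [apply: Pcx | apply: nilp_linear].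
  - exact: cone_acyclic.
  - move=> k y rk ys; rewrite QT; apply: nakayama_cone => //.
      by apply: nakT; rewrite // inE ys orbT.
    by apply: nakT; rewrite ?leqW // inE ys orbT.
apply: (nakT i x) => //; first exact: mem_head.
- exact: submodule_cocyc.
- exact: submodule_im.
- move=> z [Tz dz].
  have [|[p q] [/= Tp Tq] [/eqP dp zE]] := coneT i ri (0, z).
    split; first by split=> //; case: (Tsub i.+2).
    congr pair => /=; first by rewrite linear0 oppr0.
    by rewrite dz scaler0 addr0.
  exists p; first by split=> //; apply/eqP; rewrite -oppr_eq0.
  by exists q => //; rewrite -zE addrC addKr.
Qed.

End Cones.

Arguments cocyc {R C} P i _.
Arguments cobound {R C} P i _.

(** * Local cohomology *)

Section LocalCohomology.
Variables (R : comPzRingType) (noethR : noetherian R) (a : ideal R).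

(** Killed by [a ^ n]; with products of exactly [n] elements of [a] instead of
    elements of the ideal power, induction on [n] is available. *)
Definition killed (V : lmodType R) n : set V :=
  [set v | forall f : 'I_n -> R,
     (forall i, f i \in a) -> (\prod_i f i) *: v = 0].
Arguments killed V n _ : clear implicits.

Lemma submodule_killed V n : submodule (killed V n).
Proof.
split=> [f _|u v Ku Kv f fa|c u Ku f fa]; first by rewrite scaler0.
  by rewrite scalerDr Ku ?Kv ?addr0.
by rewrite scalerC Ku ?scaler0.
Qed.

Lemma killedS V n v :
  killed V n.+1 v <-> forall c, c \in a -> killed V n (c *: v).
Proof.
split=> [Kv c ca f fa|Kv f fa].
  pose g i := if unlift ord0 i is Some j then f j else c.
  have g0 : g ord0 = c by rewrite /g unlift_none.
  have gl i : g (lift ord0 i) = f i by rewrite /g liftK.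
  have := Kv g; rewrite big_ord_recl g0 (eq_bigr _ (fun i _ => gl i)).
  rewrite mulrC -scalerA.
  by apply=> i; rewrite /g; case: unliftP.
by rewrite big_ord_recl mulrC -scalerA Kv // => i; apply: fa.
Qed.

Lemma torsionP (V : lmodType R) v :
  reflect (exists n, killed V n v) (v \in @torsion R a V).
Proof.
apply: (iffP idP) => [/asboolP[n nv]|[n Kv]].
  by exists n => f fa; apply/nv/mem_span; exists f.
apply/asboolP; exists n => c ca.
have Ksub := submodule_colon v (submodule0 V).
by apply: (spanP Ksub _ ca) => _ [f fa ->]; apply: Kv.
Qed.

Lemma torsion_nilp (V : lmodType R) (v : V) x :
  x \in a -> v \in @torsion R a V -> nilp x v.
Proof.
move=> xa /torsionP[n Kv]; exists n.
by have := Kv (fun=> x) (fun=> xa); rewrite prodr_const card_ord.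
Qed.

(** The ideals [Z n] of the [c] such that [a ^ n] kills [c *: v] increase, hence
    [Z n.+1] is contained in [Z n] for some [n].  If 1 were not in [Z n],
    multiplying 1 by suitable powers of the generators would give some [c]
    outside [Z n] with all [t * c] in [Z n], that is, with [c] in [Z n.+1]. *)
Lemma nilps_torsion (s : seq R) (V : lmodType R) (v : V) :
  (forall N : set R^o, submodule N -> (forall t, t \in s -> N t) ->
     [set c | c \in a] `<=` N) ->
  nilps s V v -> v \in @torsion R a V.
Proof.
move=> gen sv; pose Z n : set R^o := [set c | killed V n (c *: v)].
have Zsub n : submodule (Z n) by apply/submodule_colon/submodule_killed.
have [|n Zn] := ideal_chain_stable noethR Zsub.
  move=> n c /= Kc; apply/killedS => d _.
  by case: (submodule_killed V n) => _ _; apply.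
apply/torsionP; exists n; apply: contrapT => nKv.
suff [c nZc sc] : exists2 c, ~ Z n c & forall t, t \in s -> Z n (t * c).
  apply/nZc/Zn/killedS => d da.
  suff : [set d : R^o | Z n (d * c)] d by rewrite /Z /= scalerA.
  apply: gen da => //; split=> /= [|b e|b e].
  - by rewrite mul0r; case: (Zsub n).
  - by rewrite mulrDl; case: (Zsub n) => _ + _; apply.
  - by rewrite -[(b *: e) * c]mulrA; case: (Zsub n) => _ _; apply.
elim: s sv {gen} => [|t s IH] sv; first by exists 1; rewrite // /Z /= scale1r.
have [|c nZc sc] := IH; first by move=> y ys; apply: sv; rewrite inE ys orbT.
have [k tk] : nilp t v by apply: sv; apply: mem_head.
have : Z n (t ^+ k * c).
  by rewrite /Z /= mulrC -scalerA tk scaler0; case: (submodule_killed V n).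
elim: k {tk} => [|k IHk] Ztk; first by rewrite mul1r in Ztk.
have [/IHk//|nZk] := pselect (Z n (t ^+ k * c)).
exists (t ^+ k * c) => // y; rewrite inE => /predU1P[->|/sc Zy].
  by rewrite mulrA -exprS.
by rewrite mulrCA; case: (Zsub n) => _ _; apply.
Qed.

Variables (M : lmodType R) (I : injective_resolution M) (s : seq R).
Hypothesis sa : forall t, t \in s -> t \in a.
Hypothesis gen : forall N : set R^o,
  submodule N -> (forall t, t \in s -> N t) -> [set c | c \in a] `<=` N.

Let T j : set (I j) := setT `&` nilps s (I j).

Let torsionE j (v : I j) : (v \in @torsion R a (I j)) <-> T v.
Proof.
split=> [v_tors|[_]]; last exact: nilps_torsion.
by split=> // x /sa xa; apply: torsion_nilp v_tors.
Qed.

Let lift_cocyc i v : cocyc T i v ->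
  exists z : cocycles (torsion_complex a I) i, val (val z) = v.
Proof.
move=> [/torsionE vT dv].
pose w : torsion_module a (I i) :=
  exist (fun u => u \in @torsion R a (I i)) v vT.
have wker : w \in ker (cdiff (torsion_complex a I) i).
  by apply/eqP/val_inj.
by exists (exist (fun u => u \in ker (cdiff (torsion_complex a I) i)) w wker).
Qed.

Let cocycleP i (z : cocycles (torsion_complex a I) i) : cocyc T i (val (val z)).
Proof.
split; first exact/torsionE/(valP (val z)).
by have /eqP/(congr1 val) := valP z.
Qed.

Let coboundaryP i (z : cocycles (torsion_complex a I) i.+1) :
  reflect (cobound T i (val (val z)))
    (z \in @coboundary R (torsion_complex a I) i.+1).
Proof.
apply: (iffP (asboolP _)) => [[y dy]|[y /torsionE yT dy]].
  by exists (val y); [exact/torsionE/(valP y) | rewrite -dy].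
exists (exist (fun u => u \in @torsion R a (I i)) y yT :
  torsion_module a (I i)).
exact: val_inj.
Qed.

Lemma zero_local_cohomology i : cocyc T i.+1 `<=` cobound T i ->
  zero_module (local_cohomology a I i.+1).
Proof.
move=> TT q; have [z <-] := quot_proj_surj q.
rewrite -[0](linear0 (quot_proj _)); apply/quot_proj_eq; rewrite subr0.
by apply/coboundaryP/TT/cocycleP.
Qed.

Lemma nakayama_local_cohomology i x : x \in s ->
  coatomic (local_cohomology a I i.+1) ->
  nakayama x (cocyc T i.+1) (cobound T i).
Proof.
move=> xs coat A B Asub Bsub AZ TB AxB u Au.
pose X : lmodType R := local_cohomology a I i.+1.
pose pi : {linear cocycles (torsion_complex a I) i.+1 -> X} := quot_proj _.
pose vv : {linear cocycles (torsion_complex a I) i.+1 -> I i.+1} := val \o val.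
have xnil (q : X) : nilp x q.
  have [z <-] := quot_proj_surj q; apply: (nilp_linear pi).
  have [[_ /(_ x xs)[n xn]] _] := cocycleP z; exists n.
  by do 2!apply: val_inj.
pose im (S : set (I i.+1)) := pi @` [set z | S (vv z)].
have imsub S : submodule S -> submodule (im S).
  by move=> Ssub; apply: submodule_im; apply: (submodule_preim vv).
have [z zu] := lift_cocyc (AZ _ Au).
have AxBim q : im A q -> exists2 q', im A q' & im B (q - x *: q').
  move=> [w Aw <-]; have [v Av Bv] := AxB _ Aw.
  have [y yv] := lift_cocyc (AZ _ Av).
  exists (pi y); first by exists y; rewrite //= /vv /= yv.
  exists (w - x *: y); last by rewrite (linearB pi) (linearZZ pi).
  by rewrite /mkset (linearB vv) (linearZZ vv) /= yv.
have imAB : im A `<=` im B.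
  exact: (coatomic_nakayama coat xnil noethR (imsub _ Asub) (imsub _ Bsub)).
have [|z' Bz' /esym/quot_proj_eq/coboundaryP zz'] := imAB (pi z).
  by exists z => //=; rewrite zu.
have -> : u = vv (z - z') + vv z' by rewrite -linearD subrK -zu.
case: Bsub => _ BD _; apply: BD => //.
exact: TB.
Qed.

End LocalCohomology.

Theorem theorem3p9 (R : comPzRingType) (noethR : noetherian R) (a : ideal R)
    (M : lmodType R) (fgM : finitely_generated M) (r : nat) (r_ge1 : (1 <= r)%N)
    (I : injective_resolution M) :
  [<-> (forall i : nat, (r <= i)%N -> zero_module (local_cohomology a I i));
       (forall i : nat, (r <= i)%N ->
          finitely_generated (local_cohomology a I i));
       (forall i : nat, (r <= i)%N -> coatomic (local_cohomology a I i))].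
Proof.
tfae => [H0 i ri|fg i ri|coat i ri].
- by exists [::] => v; rewrite (H0 i ri v) rpred0.
- exact/finitely_generated_coatomic/fg.
have [s [sa gen]] := ideal_generators noethR (submodule_closed a).
case: r r_ge1 coat ri => // r _ coat; case: i => // i ri.
apply: (zero_local_cohomology noethR sa gen).
apply: (torsion_cohomology_vanishing noethR (r := r)) ri =>
  [j|j|j v|j z [_]|j x rj xs].
- exact: ires_injective.
- by exists idfun.
- by [].
- by move=> /ires_exactS[y <-]; exists y.
- exact: (nakayama_local_cohomology noethR sa gen xs (coat j.+1 rj)).
Qed.
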